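(* Let $0<\lambda\le\Lambda$ and let $u:\mathbb{R}^n\to\mathbb{R}$ be an entire solution of $$\mathscr{M}^-(\nabla^2u)=F'(u)$$ such that $u\in C^2(\mathbb{R}^n)\cap L^\infty(\mathbb{R}^n)$, $\nabla u\in C^{\alpha}_{loc}(\mathbb{R}^n;\mathbb{R}^n)$ for some $\alpha\in(0,1)$, and there exists $C=C(\|u\|_{L^\infty(\mathbb{R}^n)})>0$ with $|\nabla u(x)|\le C$ for all $x\in\mathbb{R}^n$. Assume that $F''(u)\ge0$. Then $u$ is a constant.
   Context: $F:\mathbb{R}\to\mathbb{R}$ is a function with derivatives $F',F''$. For a symmetric $n\times n$ matrix $A$ with eigenvalues $e_i=e_i(A)$, the Pucci extremal operator $\mathscr{M}^-$ is $$\mathscr{M}^-(A)=\mathscr{M}^-(A,\lambda,\Lambda)=\lambda\sum_{e_i>0}e_i+\Lambda\sum_{e_i<0}e_i .$$ *)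

(* Defs.v *)
From mathcomp Require Import all_boot all_order all_algebra.
From mathcomp Require Import all_classical all_reals all_analysis.
From mathcomp Require Import complex.

Set Implicit Arguments.
Unset Strict Implicit.
Unset Printing Implicit Defensive.

Import Order.TTheory GRing.Theory Num.Theory.
Import numFieldNormedType.Exports.

Local Open Scope classical_set_scope.
Local Open Scope ring_scope.

Section Euclidean.
Context {R : realType} {n : nat}.
Implicit Types (f : 'rV[R]_n -> R) (x v : 'rV[R]_n) (i j : 'I_n).

(* The norm `|v| that the library puts on row vectors is the sup norm. *)
Definition enorm v : R := Num.sqrt (\sum_i v 0 i ^+ 2).

Definition partial i f x : R := 'D_(delta_mx 0 i) f x.

Definition gradient f x : 'rV[R]_n := \row_i partial i f x.

Definition hessian f x : 'M[R]_n := \matrix_(i, j) partial i (partial j f) x.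

Definition C1 f : Prop :=
  (forall i x, derivable f x (delta_mx 0 i)) /\
  (forall i, continuous (partial i f)).

Definition C2 f : Prop := C1 f /\ (forall i, C1 (partial i f)).

Definition holder_loc (alpha : R) (g : 'rV[R]_n -> 'rV[R]_n) : Prop :=
  forall K : set 'rV[R]_n, compact K ->
    exists L : R, forall x y, K x -> K y ->
      enorm (g x - g y) <= L * enorm (x - y) `^ alpha.

End Euclidean.

Section Pucci.
Context {R : realType} {n : nat}.
Implicit Types (A : 'M[R]_n) (s : seq R).

(* Eigenvalues repeated according to multiplicity, in an unspecified order;
   junk value [::] when the characteristic polynomial does not split over R,
   which cannot happen for symmetric A (char_poly_eigenvalues below). *)
Definition eigenvalues A : seq R :=
  xget [::] [set s | char_poly A = \prod_(e <- s) ('X - e%:P)].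

Definition pucci_minus (lam Lam : R) A : R :=
  lam * (\sum_(e <- eigenvalues A | 0 < e) e) +
  Lam * (\sum_(e <- eigenvalues A | e < 0) e).

Lemma char_poly_eigenvalues A : A^T = A ->
  char_poly A = \prod_(e <- eigenvalues A) ('X - e%:P).
Proof.
move=> symA; rewrite /eigenvalues; case: xgetP => [s _ //|nos].
have [s sE] : exists s, char_poly A = \prod_(e <- s) ('X - e%:P); last first.
  by case: (nos s).
pose B : 'M[R[i]]_n := map_mx (real_complex R) A.
have hB : B \is hermsymmx.
  apply/is_hermitianmxP; rewrite expr0 scale1r.
  apply/matrixP => i j; rewrite !mxE -[in LHS]symA mxE.
  by apply/eqP; rewrite eq_complex /= oppr0 !eqxx.
have /hermitian_normalmx/orthomx_spectralP BE := hB.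
have dreal := hermitian_spectral_diag_real hB.
pose d i : R := complex.Re (spectral_diag B 0 i).
have dE i : spectral_diag B 0 i = (d i)%:C%C.
  have /mxOverP/(_ 0 i) := dreal; rewrite /d.
  by move=> /complex_realP[k ->].
exists [seq d i | i <- enum 'I_n].
apply: (map_poly_inj (real_complex R)); rewrite map_char_poly -/B.
rewrite map_prod_XsubC big_map big_enum /=.
have PU := spectral_unit B; set P := spectralmx B in BE PU.
have charB : char_poly B = char_poly (diag_mx (spectral_diag B)).
  have PVP : map_mx polyC (invmx P) *m map_mx polyC P = 1%:M.
    by rewrite -map_mxM mulVmx// map_mx1.
  rewrite /char_poly /char_poly_mx [in LHS]BE.
  have -> : 'X%:M - map_mx polyC (invmx P *m diag_mx (spectral_diag B) *m P) =
    map_mx polyC (invmx P) *m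
      ('X%:M - map_mx polyC (diag_mx (spectral_diag B))) *m map_mx polyC P.
    by rewrite mulmxBr mulmxBl !mul_mx_scalar -!scalemxAl PVP scalemx1 !map_mxM.
  by rewrite !det_mulmx mulrAC -det_mulmx PVP det1 mul1r.
rewrite charB char_poly_trig ?diag_mx_is_trig//.
by apply: eq_bigr => i _; rewrite mxE eqxx mulr1n dE.
Qed.

Lemma pucci_minusE (lam Lam : R) A s :
  char_poly A = \prod_(e <- s) ('X - e%:P) ->
  pucci_minus lam Lam A =
  lam * (\sum_(e <- s | 0 < e) e) + Lam * (\sum_(e <- s | e < 0) e).
Proof.
move=> sE; have tE : char_poly A = \prod_(e <- eigenvalues A) ('X - e%:P).
  by rewrite /eigenvalues; case: xgetP => [_ -> //|/(_ s)].
have st : perm_eq (eigenvalues A) s.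
  by apply: prod_XsubC_eq; rewrite -tE.
by rewrite /pucci_minus !(perm_big _ st).
Qed.

End Pucci.

(* Main.v *)
Require Import Defs.
From mathcomp Require Import all_boot all_order all_algebra.
From mathcomp Require Import all_classical all_reals all_analysis.
From mathcomp Require Import complex ring lra.

Import Order.TTheory GRing.Theory Num.Theory.
Import numFieldNormedType.Exports.

Local Open Scope ring_scope.
Local Open Scope classical_set_scope.

(** The theorem is a Liouville theorem, obtained by Bernstein's method: a bound
    for the gradient comes from the maximum principle applied to an auxiliary
    function built from a derivative of [u] and a small multiple of a square.

    Write [f] for the derivative of [F]. It is nondecreasing on the range of [u]
    ([monotone_on_range]), so there is a number [c] such that
    [(u - c) f(u) >= 0] everywhere ([sign_change_point]). Fix a direction [e] and consider,
    for small positive [s] and [h],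

      [Q y = (u (y + h e) - u y) / h + s (u y - c) ^ 2 - s ^ 3 |y| ^ 2].

    Since [u] and its gradient are bounded, [Q] attains its maximum at some
    point [x0] of a ball whose radius does not depend on [h]
    ([exists_max_penalized]). If the increment of [u] at [x0] is negative, then
    [Q <= O(s)] at once. Otherwise let [S] be the matrix with spectrum in
    [[lam, Lam]] such that [tr (S B) >= pucci_minus B] for every symmetric [B],
    with equality at the Hessian of [u] at [x0] ([pucci_minus_support]). Apply
    [L = tr (S D^2)] to [Q] at [x0], where the result must be nonpositive. The
    increment contributes at least [(f (u (x0 + h e)) - f (u x0)) / h], which is
    nonnegative because [f] is monotone. The square contributes
    [2 s (u - c) f(u)], nonnegative by the choice of [c], and an energy term at
    least [2 s lam |grad u| ^ 2]. The penalty contributes at least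
    [- 2 s ^ 3 n Lam]. Hence [|grad u|] is [O(s)] at [x0] ([gradient_at_max]).

    The difference quotient is within [s] of the derivative along [e], uniformly
    on the ball, once [h] is small ([uniform_difference_quotient]); so
    [Q x0 <= O(s)], and therefore the derivative of [u] along [e] at any given
    point is [O(s)] ([dir_deriv_le_multiple]). As [s] tends to 0 it is nonpositive.
    This holds for all [e] and all points, so [u] is constant. *)

Set Implicit Arguments.
Unset Strict Implicit.
Unset Printing Implicit Defensive.

(** * Spectral resolution and the Pucci operator *)

Section Spectral.
Context {R : realType}.

Lemma map_Re_mulmx m n p (M : 'M[R[i]]_(m, n)) (N : 'M[R[i]]_(n, p)) :
  map_mx (@complex.Re R) (M *m N) =
  map_mx (@complex.Re R) M *m map_mx (@complex.Re R) N
  - map_mx (@complex.Im R) M *m map_mx (@complex.Im R) N.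
Proof.
apply/matrixP => i j; rewrite !mxE raddf_sum /= -sumrB.
by apply: eq_bigr => k _; rewrite !mxE; case: (M i k) (N k j) => [a b] [c d].
Qed.

Lemma map_Im_mulmx m n p (M : 'M[R[i]]_(m, n)) (N : 'M[R[i]]_(n, p)) :
  map_mx (@complex.Im R) (M *m N) =
  map_mx (@complex.Re R) M *m map_mx (@complex.Im R) N
  + map_mx (@complex.Im R) M *m map_mx (@complex.Re R) N.
Proof.
apply/matrixP => i j; rewrite !mxE raddf_sum /= -big_split.
by apply: eq_bigr => k _; rewrite !mxE; case: (M i k) (N k j) => [a b] [c d].
Qed.

Lemma char_poly_conj (K : comNzRingType) n (M P Q : 'M[K]_n) :
  Q *m P = 1%:M -> char_poly (Q *m M *m P) = char_poly M.
Proof.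
move=> QP; have QPX : map_mx polyC Q *m map_mx polyC P = 1%:M.
  by rewrite -map_mxM QP map_mx1.
rewrite /char_poly /char_poly_mx.
have -> : 'X%:M - map_mx polyC (Q *m M *m P) =
    map_mx polyC Q *m ('X%:M - map_mx polyC M) *m map_mx polyC P.
  by rewrite mulmxBr mulmxBl mul_mx_scalar -scalemxAl QPX scalemx1 !map_mxM.
by rewrite !det_mulmx mulrAC -det_mulmx QPX det1 mul1r.
Qed.

(** Orthogonal diagonalization, read off from the unitary diagonalization over
    [R[i]]: if the unitary matrix is [P = X + i Y], taking real parts of
    [P^* P = 1], [P P^* = 1], [A = P^* D P] and [P A P^* = D] gives the four real
    identities below. They say that the pairs (row k of X, row k of Y) behave
    together like one orthonormal eigenbasis. *)
Lemma real_spectral_resolution n (A : 'M[R]_n) : A^T = A ->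
  exists X Y (d : 'rV[R]_n),
  [/\ char_poly A = \prod_k ('X - (d 0 k)%:P),
      X^T *m X + Y^T *m Y = 1%:M,
      X *m X^T + Y *m Y^T = 1%:M,
      A = X^T *m diag_mx d *m X + Y^T *m diag_mx d *m Y &
      X *m A *m X^T + Y *m A *m Y^T = diag_mx d].
Proof.
move=> symA.
pose c := real_complex R.
pose B : 'M[R[i]]_n := map_mx c A.
have hB : B \is hermsymmx.
  apply/is_hermitianmxP; rewrite expr0 scale1r.
  apply/matrixP => i j; rewrite !mxE -[in LHS]symA mxE.
  by apply/eqP; rewrite eq_complex /= oppr0 !eqxx.
have /hermitian_normalmx/orthomx_spectralP := hB.
have /mxOverP dreal := hermitian_spectral_diag_real hB.
have PU := spectral_unitarymx B.
rewrite invmx_unitary //; set P := spectralmx B in PU *.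
pose d : 'rV[R]_n := map_mx (@complex.Re R) (spectral_diag B).
have -> : spectral_diag B = map_mx c d.
  apply/rowP => i; rewrite !mxE; have /complex_realP[k ->] := dreal 0 i.
  by [].
rewrite -map_diag_mx => BE.
pose X := map_mx (@complex.Re R) P; pose Y := map_mx (@complex.Im R) P.
set Pt := (P ^t* )%sesqui in BE.
have XtE : map_mx (@complex.Re R) Pt = X^T.
  by apply/matrixP => i j; rewrite !mxE; case: (P j i).
have YtE : map_mx (@complex.Im R) Pt = - Y^T.
  by apply/matrixP => i j; rewrite !mxE; case: (P j i).
have ReC m p (M : 'M[R]_(m, p)) : map_mx (@complex.Re R) (map_mx c M) = M.
  by apply/matrixP => i j; rewrite !mxE.
have ImC m p (M : 'M[R]_(m, p)) : map_mx (@complex.Im R) (map_mx c M) = 0.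
  by apply/matrixP => i j; rewrite !mxE.
have PPt : P *m Pt = map_mx c 1%:M by rewrite map_mx1; exact/unitarymxP.
have PtP : Pt *m P = map_mx c 1%:M.
  by rewrite map_mx1; apply: mulmx1C; rewrite PPt map_mx1.
have PBPt : P *m B *m Pt = map_mx c (diag_mx d).
  by rewrite BE !mulmxA PPt -!mulmxA PPt map_mx1 mul1mx mulmx1.
exists X, Y, d; split.
- apply: (map_poly_inj c); rewrite map_char_poly -/B.
  rewrite BE char_poly_conj; last by rewrite PtP map_mx1.
  rewrite -map_char_poly char_poly_trig ?diag_mx_is_trig//.
  congr (map_poly c _); apply: eq_bigr => i _; by rewrite mxE eqxx mulr1n.
- by rewrite -[RHS]ReC -PtP map_Re_mulmx XtE YtE -/X -/Y mulNmx opprK.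
- by rewrite -[RHS]ReC -PPt map_Re_mulmx XtE YtE -/X -/Y mulmxN opprK.
- rewrite -[LHS]ReC -/B BE !(map_Re_mulmx, map_Im_mulmx) !(ReC, ImC) XtE YtE -/X -/Y.
  by rewrite !mulmx0 subr0 add0r !mulNmx opprK.
- rewrite -[RHS]ReC -PBPt !(map_Re_mulmx, map_Im_mulmx) !(ReC, ImC) XtE YtE -/X -/Y.
  by rewrite !mulmx0 subr0 add0r !mulmxN opprK.
Qed.

Lemma pucci_minus_diag n (lam Lam : R) (A : 'M[R]_n) (d : 'rV[R]_n) :
  char_poly A = \prod_k ('X - (d 0 k)%:P) ->
  pucci_minus lam Lam A =
    \sum_k (if 0 < d 0 k then lam else Lam) * d 0 k.
Proof.
move=> charA.
rewrite (@pucci_minusE _ _ _ _ _ [seq d 0 k | k <- index_enum 'I_n]); last first.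
  by rewrite big_map.
rewrite !big_map !mulr_sumr [in LHS]big_mkcond.
rewrite [X in _ + X]big_mkcond -big_split; apply: eq_bigr => k _ /=.
by case: ltgtP => [| |<-]; rewrite ?mulr0 ?addr0 ?add0r.
Qed.

Lemma sum_col_sqr m n (M : 'M[R]_(m, n)) j :
  \sum_i M i j ^+ 2 = (M^T *m M) j j.
Proof. by rewrite mxE; apply: eq_bigr => i _; rewrite mxE expr2. Qed.

Lemma diag_conj m n (G : 'M[R]_(m, n)) (e : 'rV[R]_n) i :
  (G *m diag_mx e *m G^T) i i = \sum_j e 0 j * G i j ^+ 2.
Proof.
rewrite mul_mx_diag mxE; apply: eq_bigr => j _.
by rewrite !mxE expr2 mulrCA mulrA.
Qed.

(** The operator [pucci_minus] is the infimum of the linear functionals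
    [B |-> tr (S B)] over the symmetric [S] with spectrum in [[lam, Lam]], and
    the infimum at [A] is attained. Here [S = V^T V], and the rows of [V] are the
    real and imaginary parts of a unitary eigenbasis of [A], scaled by the square
    root of [lam] or [Lam] according to the sign of the eigenvalue, so that [tr (S B)] is a sum of values of the
    quadratic form of [B] on rows of [V], that is, of second directional
    derivatives when [B] is a Hessian. The upper bound for [pucci_minus B] holds
    because the matrix [c] of squared moduli of scalar products between two
    unitary bases is doubly stochastic: each eigenvalue of [B] is weighted by a mean of
    numbers in [[lam, Lam]]. *)
Lemma pucci_minus_support n (lam Lam : R) (A : 'M[R]_n) :
  0 < lam -> lam <= Lam -> A^T = A ->
  exists m (V : 'M[R]_(m, n)),
  [/\ \tr (V *m A *m V^T) = pucci_minus lam Lam A,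
      forall B : 'M[R]_n, B^T = B -> pucci_minus lam Lam B <= \tr (V *m B *m V^T),
      forall w : 'cV[R]_n, lam * \sum_j w j 0 ^+ 2 <= \sum_k (V *m w) k 0 ^+ 2 &
      \tr (V *m V^T) <= n%:R * Lam].
Proof.
move=> lam0 lamLam symA.
have Lam0 : 0 < Lam by exact: lt_le_trans lamLam.
have [X [Y [d [charA XtX XXt _ AE]]]] := real_spectral_resolution symA.
pose a k := if 0 < d 0 k then lam else Lam.
have a_lam k : lam <= a k by rewrite /a; case: ifP.
have a_Lam k : a k <= Lam by rewrite /a; case: ifP.
have a_ge0 k : 0 <= a k by rewrite (le_trans (ltW lam0)).
pose r : 'rV[R]_n := \row_k Num.sqrt (a k).
pose V := col_mx (diag_mx r *m X) (diag_mx r *m Y).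
have trV (M : 'M[R]_n) :
    \tr (V *m M *m V^T) = \sum_k a k * (X *m M *m X^T + Y *m M *m Y^T) k k.
  rewrite /V mul_col_mx tr_col_mx mul_col_row mxtrace_block -big_split /=.
  apply: eq_bigr => k _; rewrite !trmx_mul !tr_diag_mx !mulmxA.
  rewrite !mul_mx_diag -!mulmxA !mul_diag_mx !mxE.
  by rewrite -[in RHS](sqr_sqrtr (a_ge0 k)); ring.
exists (n + n)%N, V; split.
- rewrite trV AE (pucci_minus_diag lam Lam charA); apply: eq_bigr => k _.
  by rewrite mxE eqxx mulr1n.
- move=> B symB.
  have [Z [W [e [charB _ ZZt BE _]]]] := real_spectral_resolution symB.
  rewrite trV (pucci_minus_diag lam Lam charB).
  pose c k j := (X *m Z^T) k j ^+ 2 + (X *m W^T) k j ^+ 2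
              + ((Y *m Z^T) k j ^+ 2 + (Y *m W^T) k j ^+ 2).
  have c_ge0 k j : 0 <= c k j by rewrite !addr_ge0 ?sqr_ge0.
  have sum_c j : \sum_k c k j = 1.
    rewrite !big_split /= !sum_col_sqr !trmx_mul !trmxK.
    have -> : 1 = (1%:M : 'M[R]_n) j j by rewrite mxE eqxx.
    have mxD (M N : 'M[R]_n) : (M + N) j j = M j j + N j j by rewrite mxE.
    have TT (T : 'M[R]_n) :
        T *m T^T = T *m X^T *m X *m T^T + T *m Y^T *m Y *m T^T.
      by rewrite -mulmxDl -!(mulmxA T) -mulmxDr XtX mulmx1.
    by rewrite -ZZt !TT !mulmxA !mxD; ring.
  have XB k : (X *m B *m X^T + Y *m B *m Y^T) k k = \sum_j e 0 j * c k j.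
    have conjB (T : 'M[R]_n) : T *m B *m T^T =
        (T *m Z^T) *m diag_mx e *m (T *m Z^T)^T
        + (T *m W^T) *m diag_mx e *m (T *m W^T)^T.
      by rewrite BE !mulmxDr !mulmxDl !trmx_mul !trmxK !mulmxA.
    rewrite !conjB [LHS]mxE [X in X + _]mxE [X in _ + X]mxE !diag_conj -!big_split /=.
    by apply: eq_bigr => j _; rewrite /c; ring.
  under [leRHS]eq_bigr => k _ do rewrite XB mulr_sumr.
  rewrite exchange_big; apply: ler_sum => j _ /=.
  have sum_le : \sum_k a k * c k j <= Lam.
    rewrite -[leRHS]mulr1 -(sum_c j) mulr_sumr; apply: ler_sum => k _.
    exact: ler_wpM2r.
  have sum_ge : lam <= \sum_k a k * c k j.
    rewrite -[leLHS]mulr1 -(sum_c j) mulr_sumr; apply: ler_sum => k _.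
    exact: ler_wpM2r.
  have -> : \sum_k a k * (e 0 j * c k j) = (\sum_k a k * c k j) * e 0 j.
    by rewrite mulr_suml; apply: eq_bigr => k _; ring.
  case: ltP => ej; first by rewrite ler_pM2r.
  exact: ler_wnM2r.
- move=> w.
  have -> : \sum_k (V *m w) k 0 ^+ 2 = \sum_k a k * ((X *m w) k 0 ^+ 2 + (Y *m w) k 0 ^+ 2).
    rewrite /V mul_col_mx big_split_ord /= -big_split /=.
    apply: eq_bigr => k _; rewrite col_mxEu col_mxEd -!mulmxA !mul_diag_mx !mxE.
    by rewrite -[in RHS](sqr_sqrtr (a_ge0 k)); ring.
  have -> : \sum_j w j 0 ^+ 2 = \sum_k ((X *m w) k 0 ^+ 2 + (Y *m w) k 0 ^+ 2).
    rewrite big_split /= !sum_col_sqr -[in LHS](mulmx1 w^T) -XtX !trmx_mul.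
    by rewrite mulmxDr mulmxDl !mulmxA mxE.
  rewrite mulr_sumr; apply: ler_sum => k _.
  by apply: ler_wpM2r => //; rewrite addr_ge0 ?sqr_ge0.
- rewrite -[V in V *m _]mulmx1 trV !mulmx1 XXt.
  apply: le_trans (_ : \sum_(k < n) Lam <= _).
    by apply: ler_sum => k _; rewrite mxE eqxx mulr1.
  by rewrite sumr_const card_ord mulr_natl.
Qed.

End Spectral.

(** * One-variable calculus and restriction to lines *)

Section Lines.
Context {R : realType}.

Lemma is_derive_line (V : normedModType R) (f : V -> R) (x v : V) (t l : R) :
  is_derive (x + t *: v) v f l ->
  is_derive t 1 (fun s : R => f (x + s *: v)) l.
Proof.
move=> [dl vl].
have E : (fun h : R => h^-1 *: (f (x + (h *: 1 + t) *: v) - f (x + t *: v)))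
       = (fun h : R => h^-1 *: (f (h *: v + (x + t *: v)) - f (x + t *: v))).
  apply/funext => h; congr (_ *: (f _ - _)).
  by rewrite [h *: 1]mulr1 scalerDl addrCA.
by split; [rewrite /derivable E|rewrite /derive E].
Qed.

(** The mean value theorem with endpoints in either order; the two distances
    locate the intermediate point without a case distinction. *)
Lemma MVT_dist (g dg : R -> R) (a b : R) :
  (forall t : R, is_derive t 1 g (dg t)) ->
  exists c, [/\ `|c - a| <= `|b - a|, `|c - b| <= `|b - a|
              & g b - g a = dg c * (b - a)].
Proof.
move=> gd.
have gc (i : interval R) : {within [set` i], continuous g}.
  by apply: derivable_within_continuous => x _; apply: ex_derive.
case: (leP a b) => ab.
  have [c + gE] := MVT_segment ab (fun x _ => gd x) (gc _).
  rewrite in_itv /= => /andP[ac cb]; exists c; split => //.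
    by rewrite !ger0_norm ?subr_ge0 // lerD2r.
  by rewrite distrC !ger0_norm ?subr_ge0 // lerD2l lerN2.
have [c + gE] := MVT_segment (ltW ab) (fun x _ => gd x) (gc _).
rewrite in_itv /= => /andP[bc ca]; exists c; split.
- by rewrite ![`|_ - a|]distrC !ger0_norm ?subr_ge0 ?(ltW ab) // lerD2l lerN2.
- by rewrite [`|_ - a|]distrC !ger0_norm ?subr_ge0 ?(ltW ab) // lerD2r.
- by rewrite -opprB gE -mulrN opprB.
Qed.

(** If [m] were positive, [dg] would be positive on a right neighbourhood of the
    critical point 0, and [g] would increase there. *)
Lemma second_derivative_at_max (g dg : R -> R) (m : R) :
  (forall t : R, is_derive t 1 g (dg t)) -> is_derive (0 : R) 1 dg m ->
  (forall t, g t <= g 0) -> m <= 0.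
Proof.
move=> gd [dgd dgm] gmax; rewrite leNgt; apply/negP => m0.
have dg0 : dg 0 = 0.
  have g0 : is_derive (0 : R) 1 g 0.
    by apply: (@derive1_at_max _ g (-1) 1) => //; rewrite ?in_itv /=; lra.
  have := @derive_val _ _ _ _ _ _ _ (gd 0).
  by rewrite (@derive_val _ _ _ _ _ _ _ g0).
have cvgm : h^-1 *: (dg (h *: 1 + 0) - dg 0) @[h --> 0^'] --> m.
  by rewrite -dgm; exact: dgd.
have [e /= e0 He] := cvgr_gt _ cvgm _ m0.
have e20 : 0 < e / 2 by lra.
have gcont : {within `[0, e / 2], continuous g}.
  by apply: derivable_within_continuous => x _; apply: ex_derive.
have [c + gE] := MVT e20 (fun x _ => gd x) gcont.
rewrite in_itv /= => /andP[c0 ce].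
have := He c; rewrite /ball /= sub0r normrN (gt_eqF c0) gtr0_norm //.
move=> /(_ _ isT); rewrite dg0 subr0 addr0 [c *: 1]mulr1.
have -> : c < e by lra.
move=> /(_ isT); rewrite [_ *: _]mulrC pmulr_lgt0 ?invr_gt0 // => dgc.
have := gmax (e / 2); rewrite -subr_le0 gE subr0 leNgt.
by rewrite mulr_gt0.
Qed.

End Lines.

Section Euclidean_calculus.
Context {R : realType} {n : nat}.
Implicit Types (f g u : 'rV[R]_n -> R) (x y v w h p q e : 'rV[R]_n).

(** * Functions of class C1 and C2 *)

Definition dir_deriv f v x : R := \sum_i v 0 i * partial i f x.

Lemma ler_coord_norm v i : `|v 0 i| <= `|v|.
Proof.
rewrite [leRHS]/Num.norm /= mx_normrE.
by apply/bigmax_geP; right => /=; exists (0, i).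
Qed.

Lemma ler_norm_coord v (r : R) : 0 <= r -> (forall i, `|v 0 i| <= r) -> `|v| <= r.
Proof.
move=> r0 vr; rewrite [leLHS]/Num.norm /= mx_normrE.
by apply: bigmax_le => // -[i j] _ /=; rewrite ord1.
Qed.

Lemma partial_mean_value f i x (t : R) :
  (forall y, derivable f y (delta_mx 0 i)) ->
  exists s : R, `|s| <= `|t| /\
    f (x + t *: delta_mx 0 i) - f x = t * partial i f (x + s *: delta_mx 0 i).
Proof.
move=> fd.
have gd (s : R) : is_derive s 1 (fun s : R => f (x + s *: delta_mx 0 i))
    (partial i f (x + s *: delta_mx 0 i)).
  by apply: is_derive_line; split.
have [s [+ _]] := MVT_dist 0 t gd.
by rewrite !subr0 scale0r addr0 mulrC => ds gE; exists s.
Qed.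

(** Continuous partial derivatives give a first-order expansion: go from [x] to
    [x + h] one coordinate at a time, and apply the mean value theorem on each
    segment; all intermediate points stay within sup-distance [|h|] of [x]. *)
Lemma C1_first_order f x (e : R) : C1 f -> 0 < e ->
  exists2 d : R, 0 < d & forall h, `|h| < d ->
    `|f (x + h) - f x - dir_deriv f h x| <= e * `|h|.
Proof.
move=> [fd fc] e0.
pose e' := e / n.+1%:R.
have e'0 : 0 < e' by rewrite divr_gt0.
have : \forall y \near x, forall i, `|partial i f x - partial i f y| <= e'.
  apply: (@filter_forall _ _ (fun i y => `|partial i f x - partial i f y| <= e')
    (nbhs x) _) => i.
  exact: cvgr_dist_le (fc i x) _ e'0.
move=> /nbhs_ballP[d /= d0 Hd].
exists d => // h hd.
(* [p k] has already moved in the first k coordinates. *)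
pose cut k : 'rV[R]_n := \row_j (if (j < k)%N then h 0 j else 0).
pose p k := x + cut k.
have p0 : p 0%N = x.
  by rewrite -[RHS]addr0; congr (_ + _); apply/rowP => j; rewrite !mxE.
have pn : p n = x + h.
  by congr (_ + _); apply/rowP => j; rewrite !mxE ltn_ord.
have pS (k : 'I_n) : p k.+1 = p k + h 0 k *: delta_mx 0 k.
  rewrite -addrA; congr (_ + _); apply/rowP => j; rewrite !mxE eqxx /=.
  rewrite ltnS leq_eqVlt -(inj_eq val_inj) /=.
  by case: eqVneq => [/val_inj ->|_] /=; rewrite ?ltnn ?add0r ?mulr1 ?mulr0 ?addr0.
have tele : f (x + h) - f x = \sum_(k < n) (f (p k.+1) - f (p k)).
  by rewrite -(big_mkord xpredT (fun k => f (p k.+1) - f (p k))) telescope_sumr //= pn p0.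
rewrite tele /dir_deriv -sumrB.
have bnd (k : 'I_n) : `|f (p k.+1) - f (p k) - h 0 k * partial k f x| <= e' * `|h|.
  rewrite pS; have [s [sh ->]] := @partial_mean_value f k (p k) (h 0 k) (fd k).
  rewrite -mulrBr normrM mulrC; apply: ler_pM => //; last exact: ler_coord_norm.
  rewrite distrC; apply: Hd.
  rewrite -ball_normE /= -addrA opprD addNKr normrN.
  apply: le_lt_trans hd.
  apply: ler_norm_coord => // j; rewrite !mxE eqxx /=.
  case: ltnP => jk.
    rewrite (_ : (j == k) = false) ?mulr0 ?addr0; first exact: ler_coord_norm.
    by rewrite -(inj_eq val_inj) /= ltn_eqF.
  rewrite add0r; case: eqP => _; rewrite ?mulr1 ?mulr0 ?normr0 //.
  exact: le_trans (ler_coord_norm h k).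
apply: le_trans (ler_norm_sum _ _ _) _.
apply: le_trans (ler_sum _ (fun k _ => bnd k)) _.
rewrite sumr_const card_ord -mulr_natl mulrA ler_wpM2r //.
rewrite /e' mulrCA ler_piMr ?(ltW e0) // ler_pdivrMr // mul1r ler_nat.
exact: leqnSn.
Qed.

Lemma dir_derivZ f (t : R) v x : dir_deriv f (t *: v) x = t * dir_deriv f v x.
Proof.
by rewrite /dir_deriv mulr_sumr; apply: eq_bigr => i _; rewrite mxE mulrA.
Qed.

Lemma ler_dir_deriv f v x (C : R) : (forall i, `|partial i f x| <= C) ->
  `|dir_deriv f v x| <= C * \sum_i `|v 0 i|.
Proof.
move=> fC; rewrite mulr_sumr; apply: le_trans (ler_norm_sum _ _ _) _.
by apply: ler_sum => i _; rewrite normrM mulrC ler_wpM2r.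
Qed.

Lemma C1_is_derive f x v : C1 f -> is_derive x v f (dir_deriv f v x).
Proof.
move=> f1.
have cvgf : (fun t : R => t^-1 *: (f (t *: v + x) - f x)) @ 0^' --> dir_deriv f v x.
  apply/cvgrPdist_le => e e0.
  have v1 : 0 < `|v| + 1 by rewrite ltr_wpDl.
  have [d d0 Hd] := C1_first_order x f1 (divr_gt0 e0 v1).
  near=> t.
  have t0 : t != 0 by near: t; exact: nbhs_dnbhs_neq.
  have td : `|t| < d / (`|v| + 1).
    by near: t; apply: (@dnbhs0_lt _ R); exact: divr_gt0.
  have tv : `|t *: v| < d.
    rewrite normrZ; apply: (@le_lt_trans _ _ (`|t| * (`|v| + 1))).
      by rewrite ler_wpM2l // lerDl.
    by rewrite -ltr_pdivlMr.
  have := Hd _ tv; rewrite [x + _]addrC dir_derivZ normrZ => Ht.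
  rewrite distrC -[dir_deriv f v x](mulKf t0) -[_ *: _]/(_ * _) -mulrBr normrM.
  rewrite normfV ler_pdivrMl ?normr_gt0 //; apply: le_trans Ht _.
  rewrite mulrCA ler_wpM2l // mulrAC ler_pdivrMr // ler_wpM2l ?(ltW e0) //.
  by rewrite lerDl.
split; first by apply/cvg_ex; exists (dir_deriv f v x).
exact: cvg_lim cvgf.
Unshelve. all: by end_near. Qed.

Lemma C1_continuous f : C1 f -> continuous f.
Proof.
move=> f1 x; apply/(@cvgrPdist_le _ _ _ (nbhs x)) => e e0.
have [d d0 Hd] := C1_first_order x f1 ltr01.
pose C := 1 + \sum_i `|partial i f x|.
have C0 : 0 < C by rewrite ltr_pwDl // sumr_ge0.
have r0 : 0 < Num.min d (e / C) by rewrite lt_min d0 divr_gt0.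
apply/nbhs_ballP; exists (Num.min d (e / C)) => //= y.
rewrite -ball_normE /= distrC lt_min => /andP[yd /ltW yC].
have := Hd _ yd; rewrite (addrC x) subrK mul1r => H.
have D : `|dir_deriv f (y - x) x| <= (\sum_i `|partial i f x|) * `|y - x|.
  rewrite mulr_suml; apply: le_trans (ler_norm_sum _ _ _) _.
  by apply: ler_sum => i _; rewrite normrM mulrC ler_wpM2l // ler_coord_norm.
rewrite distrC -[f y - f x](subrK (dir_deriv f (y - x) x)).
apply: le_trans (ler_normD _ _) _; apply: le_trans (lerD H D) _.
by rewrite -[X in X + _]mul1r -mulrDl mulrC -ler_pdivlMr.
Qed.

Definition quad_form (A : 'M[R]_n) v : R := (v *m A *m v^T) 0 0.

Lemma C1_is_derive_line f x v (t : R) : C1 f ->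
  is_derive t 1 (fun s : R => f (x + s *: v)) (dir_deriv f v (x + t *: v)).
Proof. by move=> f1; apply/is_derive_line/C1_is_derive. Qed.

Lemma C2_is_derive_line2 u x v (t : R) : C2 u ->
  is_derive t 1 (fun s : R => dir_deriv u v (x + s *: v))
    (quad_form (hessian u (x + t *: v)) v).
Proof.
move=> [_ u2].
have D i := @C1_is_derive_line _ x v t (u2 i).
have -> : (fun s : R => dir_deriv u v (x + s *: v)) =
    \sum_i (v 0 i *: (fun s : R => partial i u (x + s *: v))).
  by apply/funext => s; rewrite fct_sumE.
apply: is_derive_eq.
rewrite /quad_form [RHS]mxE; apply: eq_bigr => j _.
rewrite [_ *: _]mulrC !mxE; congr (_ * _); apply: eq_bigr => i _.
by rewrite mxE.
Qed.

Lemma dir_deriv_mean_value f x v : C1 f ->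
  exists s : R, [/\ 0 <= s, s <= 1 & f (x + v) - f x = dir_deriv f v (x + s *: v)].
Proof.
move=> f1.
have gd (s : R) := @C1_is_derive_line f x v s f1.
have gc : {within `[0 : R, 1], continuous (fun s : R => f (x + s *: v))}.
  by apply: derivable_within_continuous => s _; have := gd s; case.
have [s + gE] := MVT_segment ler01 (fun s _ => gd s) gc.
rewrite in_itv /= => /andP[s0 s1]; exists s; split => //.
by move: gE; rewrite scale1r scale0r addr0 subr0 mulr1.
Qed.

Definition second_difference f x p q : R :=
  f (x + q + p) - f (x + p) - (f (x + q) - f x).

Lemma second_differenceC f x p q :
  second_difference f x p q = second_difference f x q p.
Proof.
rewrite /second_difference (addrAC x q) !opprB addrACA [RHS]addrACA.
by congr (_ + _); exact: addrC.
Qed.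

(** Two applications of the mean value theorem. The left-hand side is symmetric
    in the two directions, which is why the mixed derivatives agree in the limit. *)
Lemma mixed_second_difference u i j x (t : R) : C2 u ->
  exists y, `|y - x| <= `|t| + `|t| /\
    second_difference u x (t *: delta_mx 0 i) (t *: delta_mx 0 j)
    = t * (t * partial j (partial i u) y).
Proof.
move=> [[ud _] u2].
pose g (s : R) := u (x + t *: delta_mx 0 j + s *: delta_mx 0 i)
                - u (x + s *: delta_mx 0 i).
pose dg (s : R) := partial i u (x + t *: delta_mx 0 j + s *: delta_mx 0 i)
                 - partial i u (x + s *: delta_mx 0 i).
have gd (s : R) : is_derive s 1 g (dg s).
  have D z : is_derive s 1 (fun s : R => u (z + s *: delta_mx 0 i))
      (partial i u (z + s *: delta_mx 0 i)).
    by apply: is_derive_line; split.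
  exact: is_deriveB.
have [s [+ _]] := MVT_dist 0 t gd; rewrite !subr0 => st.
rewrite {1}/g /g !scale0r !addr0 mulrC /second_difference => ->.
have [r [rt]] := @partial_mean_value _ j (x + s *: delta_mx 0 i) t ((u2 i).1 j).
rewrite /dg [x + _ + _]addrAC => ->.
exists (x + s *: delta_mx 0 i + r *: delta_mx 0 j); split=> //.
have e1 k : `|delta_mx 0 k : 'rV[R]_n| <= 1.
  by apply: ler_norm_coord => // l; rewrite !mxE eqxx /=; case: eqP; rewrite ?normr1 ?normr0.
rewrite -(addrA x) [_ - x]addrC addKr; apply: le_trans (ler_normD _ _) _.
rewrite !normrZ; apply: lerD.
  by apply: le_trans st; rewrite ler_piMr.
by apply: le_trans rt; rewrite ler_piMr.
Qed.

Lemma continuous_near f x (e : R) : continuous f -> 0 < e ->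
  exists2 d : R, 0 < d & forall y, `|y - x| < d -> `|f x - f y| < e.
Proof.
move=> fc e0.
have /nbhs_ballP[d /= d0 Hd] : \forall y \near x, `|f x - f y| < e.
  exact: cvgr_dist_lt (fc x) _ e0.
exists d => // y yx; apply: Hd.
by rewrite -ball_normE /= distrC.
Qed.

Lemma continuous_agree_near f g x : continuous f -> continuous g ->
  (forall d : R, 0 < d -> exists y z : 'rV[R]_n,
    [/\ `|y - x| < d, `|z - x| < d & f y = g z]) ->
  f x = g x.
Proof.
move=> fc gc near_eq; apply/eqP/negPn/negP => fg.
have e0 : 0 < `|f x - g x| / 2 by rewrite divr_gt0 // normr_gt0 subr_eq0.
have [df df0 Hf] := continuous_near x fc e0.
have [dg dg0 Hg] := continuous_near x gc e0.
have m0 : 0 < Num.min df dg by rewrite lt_min df0.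
have [y [z [+ + yz]]] := near_eq _ m0.
rewrite !lt_min => /andP[yf _] /andP[_ zg].
have := ltrD (Hf _ yf) (Hg _ zg); rewrite -splitr ltNge => /negP; apply.
rewrite [leLHS](_ : _ = `|(f x - f y) - (g x - g z)|) ?ler_normB //.
by rewrite yz opprB addrA subrK.
Qed.

(** Schwarz's theorem. Symmetry is what makes the eigenvalues in [pucci_minus]
    meaningful and the spectral resolution applicable. *)
Lemma hessian_sym u x : C2 u -> (hessian u x)^T = hessian u x.
Proof.
move=> u2; apply/matrixP => i j; rewrite !mxE.
apply: continuous_agree_near.
- by move: u2 => [_ H]; exact: (proj2 (H i) j).
- by move: u2 => [_ H]; exact: (proj2 (H j) i).
move=> d d0; pose t := d / 3.
have t0 : 0 < t by rewrite divr_gt0.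
have td : `|t| + `|t| < d by rewrite gtr0_norm // /t; lra.
have [y [yx yE]] := mixed_second_difference i j x t u2.
have [z [zx zE]] := mixed_second_difference j i x t u2.
exists y, z; split; [exact: le_lt_trans td|exact: le_lt_trans td|].
apply: (mulfI (lt0r_neq0 t0)); apply: (mulfI (lt0r_neq0 t0)).
exact: etrans (esym yE) (etrans (second_differenceC _ _ _ _) zE).
Qed.

(** * Maxima of penalized functions *)

Lemma compact_norm_le (r : R) : compact [set x : 'rV[R]_n | `|x| <= r].
Proof.
apply: bounded_closed_compact.
  by exists r; split; [exact: num_real|move=> t rt x /= /le_trans; apply; exact: ltW].
rewrite (_ : [set x | _] = (fun x : 'rV[R]_n => `|x|) @^-1` [set y : R | y <= r]) //.
apply: preimage_closed; last exact: closed_le.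
by move=> x _; exact: norm_continuous.
Qed.

Definition sqnorm x : R := \sum_i x 0 i ^+ 2.

Lemma sqnorm_ge0 x : 0 <= sqnorm x.
Proof. by apply: sumr_ge0 => i _; exact: sqr_ge0. Qed.

Lemma sqr_norm_le_sqnorm x : `|x| ^+ 2 <= sqnorm x.
Proof.
rewrite -[leRHS]sqr_sqrtr ?sqnorm_ge0 // ler_pXn2r ?nnegrE ?sqrtr_ge0 //.
apply: ler_norm_coord => [|i]; first exact: sqrtr_ge0.
rewrite -sqrtr_sqr ler_sqrt ?sqnorm_ge0 // /sqnorm (bigD1 i) //= lerDl.
by apply: sumr_ge0 => j _; exact: sqr_ge0.
Qed.

Lemma is_derive_sqnorm x v (t : R) :
  is_derive t 1 (fun s : R => sqnorm (x + s *: v))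
    (2 * \sum_i v 0 i * (x + t *: v) 0 i).
Proof.
have -> : (fun s : R => sqnorm (x + s *: v)) =
    \sum_i (fun s : R => (x 0 i + s * v 0 i) ^+ 2).
  apply/funext => s; rewrite fct_sumE; apply: eq_bigr => i _.
  by rewrite !mxE.
apply: is_derive_eq.
rewrite mulr_sumr; apply: eq_bigr => i _.
by rewrite !mxE /GRing.scale /=; ring.
Qed.

Lemma sqnorm_continuous : continuous sqnorm.
Proof.
apply: (@continuous_big _ _ _ _ _ _ _ _ (fun i x => x 0 i ^+ 2)) => [|i _].
  exact: add_continuous.
move=> x; apply: (@continuous_comp _ _ _ (fun x : 'rV[R]_n => x 0 i) (fun t => t ^+ 2)).
  exact: coord_continuous.
exact: exprn_continuous.
Qed.

(** The penalty makes the maximum exist on the whole space, and the radius [r]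
    depends on [phi] only through its bound [B]. The latter is essential: the
    maximum point must stay in a fixed compact set when the step of the
    difference quotient inside [phi] tends to zero. *)
Lemma exists_max_penalized (phi : 'rV[R]_n -> R) (B eps r : R) :
  continuous phi -> (forall x, `|phi x| <= B) ->
  0 < eps -> 0 <= r -> 2 * B <= eps * r ^+ 2 ->
  exists x0, `|x0| <= r /\
    forall x, phi x - eps * sqnorm x <= phi x0 - eps * sqnorm x0.
Proof.
move=> phic phiB eps0 r0 Br.
pose psi x := phi x - eps * sqnorm x.
have psic : continuous psi.
  move=> x; apply: (@continuousB _ _ _ phi (fun x => eps * sqnorm x)).
    exact: phic.
  apply: (@continuousM _ _ (cst eps) sqnorm); first exact: cst_continuous.
  exact: sqnorm_continuous.
pose K := [set x : 'rV[R]_n | `|x| <= r].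
have K0 : K 0 by rewrite /K /= normr0.
have [x0 + max0] := EVT_max_rV (ex_intro _ _ K0) (@compact_norm_le r)
  (continuous_subspaceT psic).
rewrite inE => x0r; exists x0; split => // x.
have [xr|rx] := leP `|x| r; first by apply: max0; rewrite inE.
apply: le_trans (max0 0 _); last by rewrite inE.
have : eps * r ^+ 2 <= eps * sqnorm x.
  rewrite ler_wpM2l ?(ltW eps0) //; apply: le_trans (sqr_norm_le_sqnorm x).
  by rewrite ler_pXn2r ?nnegrE // ltW.
rewrite /psi (_ : sqnorm 0 = 0) ?mulr0 ?subr0; last first.
  by apply: big1 => i _; rewrite mxE expr0n.
have := phiB x; have := phiB 0; rewrite !ler_norml => /andP[? ?] /andP[? ?] ?.
lra.
Qed.

(** * The nonlinearity on the range of the solution *)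

(** Nonnegativity of the derivative is known only on the range of [u]; the mean
    value theorem can be used because this range is an interval. *)
Lemma monotone_on_range u (f : R -> R) :
  continuous u -> (forall t : R, derivable f t 1) -> (forall x, 0 <= f^`() (u x)) ->
  forall x y, u x <= u y -> f (u x) <= f (u y).
Proof.
move=> uc fd f_ge0 x y; rewrite le_eqVlt => /predU1P[-> //|xy].
have fc : {within `[u x, u y], continuous f}.
  by apply: derivable_within_continuous => t _; exact: fd.
have fD (t : R) : is_derive t 1 f (f^`() t) by rewrite derive1E; split.
have [c + fE] := MVT xy (fun t _ => fD t) fc.
rewrite in_itv /= => /andP[xc cy].
have gc : continuous (fun s : R => u (x + s *: (y - x))).
  move=> s; apply: (@continuous_comp _ _ _ (fun s : R => x + s *: (y - x)) u); last exact: uc.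
  apply: (@continuousD _ _ _ (cst x) (fun s : R => s *: (y - x))); first exact: cst_continuous.
  exact: scalel_continuous.
have [] := @IVT R (fun s : R => u (x + s *: (y - x))) 0 1 c ler01.
- exact: continuous_subspaceT.
- rewrite scale0r addr0 scale1r (addrC x) subrK.
  by rewrite ge_min le_max (ltW xc) (ltW cy) orbT.
move=> s _ sc; rewrite -subr_ge0 fE mulr_ge0 ?subr_ge0 ?(ltW xy) // -sc.
exact: f_ge0.
Qed.

(** A nondecreasing function is nonpositive below and nonnegative above some
    threshold, possibly an end of its domain. This sign condition makes
    [(u - c) ^ 2] a subsolution of the linearized equation. *)
Lemma sign_change_point (T : Type) (u : T -> R) (f : R -> R) (M : R) :
  0 <= M -> (forall x : T, `|u x| <= M) ->
  (forall x y : T, u x <= u y -> f (u x) <= f (u y)) ->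
  exists2 c, `|c| <= M & forall x : T, 0 <= (u x - c) * f (u x).
Proof.
move=> M0 uM f_mono.
pose S := [set t | exists2 x : T, u x = t & f t <= 0].
have [S0|/set0P S_neq0] := eqVneq S set0.
  (* Here [f] is positive on the range, and any [c] below the range will do. *)
  exists (- M); rewrite ?normrN ?ger0_norm // => x.
  rewrite opprK mulr_ge0 //.
    by have := uM x; rewrite ler_norml => /andP[? _]; lra.
  rewrite leNgt; apply/negP => fx.
  suff : S (u x) by rewrite S0.
  by exists x => //; exact: ltW.
have S_ub : ubound S M by move=> _ [x <- _]; exact: le_trans (ler_norm _) (uM x).
have S_sup : has_sup S by split => //; exists M.
exists (sup S).
  have [_ [x <- fx]] := S_neq0.
  rewrite ler_norml; apply/andP; split.
    apply: (@le_trans _ _ (u x)); first by have := uM x; rewrite ler_norml => /andP[].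
    by apply: sup_upper_bound => //; exists x.
  exact: sup_le_ub.
move=> x; case: (ltgtP (u x) (sup S)) => [xS|Sx|->]; last by rewrite subrr mul0r.
  have e0 : 0 < sup S - u x by rewrite subr_gt0.
  have [_ [y <- fy]] := sup_adherent e0 S_sup; rewrite opprB addrC subrK => xy.
  apply: mulr_le0; first by rewrite subr_le0 ltW.
  exact: le_trans (f_mono _ _ (ltW xy)) fy.
apply: mulr_ge0; first by rewrite subr_ge0 ltW.
rewrite leNgt; apply/negP => fx; move: Sx; rewrite ltNge => /negP; apply.
by apply: sup_upper_bound => //; exists x => //; exact: ltW.
Qed.

(** * The gradient at a maximum point *)

(** Restricting the auxiliary function to the line through [x0] with direction
    [v] reduces the test to one variable. *)
Lemma max_second_order u (k K c eps : R) w v x0 :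
  C2 u ->
  let Q x := k * (u (x + w) - u x) + K * (u x - c) ^+ 2 - eps * sqnorm x in
  (forall x, Q x <= Q x0) ->
  k * (quad_form (hessian u (x0 + w)) v - quad_form (hessian u x0) v)
  + 2 * K * ((u x0 - c) * quad_form (hessian u x0) v + dir_deriv u v x0 ^+ 2)
  - 2 * eps * sqnorm v <= 0.
Proof.
move=> u2 Q Qmax.
pose A (t : R) := u (x0 + w + t *: v); pose B (t : R) := u (x0 + t *: v).
pose dA (t : R) := dir_deriv u v (x0 + w + t *: v).
pose dB (t : R) := dir_deriv u v (x0 + t *: v).
pose N (t : R) := sqnorm (x0 + t *: v).
pose dN (t : R) := 2 * \sum_i v 0 i * (x0 + t *: v) 0 i.
have DA (t : R) : is_derive t 1 A (dA t) by exact: C1_is_derive_line u2.1.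
have DB (t : R) : is_derive t 1 B (dB t) by exact: C1_is_derive_line u2.1.
have DN (t : R) : is_derive t 1 N (dN t) by exact: is_derive_sqnorm.
pose a := quad_form (hessian u (x0 + w)) v.
pose b := quad_form (hessian u x0) v.
have DdA : is_derive (0 : R) 1 dA a.
  by have := C2_is_derive_line2 (x0 + w) v 0 u2; rewrite scale0r addr0.
have DdB : is_derive (0 : R) 1 dB b.
  by have := C2_is_derive_line2 x0 v 0 u2; rewrite scale0r addr0.
have DdN : is_derive (0 : R) 1 dN (2 * sqnorm v).
  have -> : dN = \sum_i (fun t : R => 2 * (v 0 i * (x0 0 i + t * v 0 i))).
    apply/funext => t; rewrite fct_sumE /dN mulr_sumr.
    by apply: eq_bigr => i _; rewrite !mxE.
  apply: is_derive_eq; rewrite mulr_sumr; apply: eq_bigr => i _.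
  by rewrite /GRing.scale /=; ring.
pose g (t : R) := k * (A t - B t) + K * (B t - c) ^+ 2 - eps * N t.
pose dg (t : R) := k * (dA t - dB t) + 2 * K * ((B t - c) * dB t) - eps * dN t.
have gd (t : R) : is_derive t 1 g (dg t).
  rewrite /g; apply: is_derive_eq.
  by rewrite /dg /GRing.scale /=; ring.
have DDg : is_derive (0 : R) 1 dg (k * (a - b)
    + 2 * K * ((B 0 - c) * b + dB 0 ^+ 2) - 2 * eps * sqnorm v).
  rewrite /dg; apply: is_derive_eq.
  by rewrite /GRing.scale /=; ring.
have gmax (t : R) : g t <= g 0.
  have := Qmax (x0 + t *: v).
  by rewrite /Q /g /A /B /N (addrAC x0 w) !scale0r !addr0.
have := second_derivative_at_max gd DDg gmax.
by rewrite /dB /B scale0r addr0.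
Qed.

Lemma sum_quad_form_rows m (A : 'M[R]_n) (V : 'M[R]_(m, n)) :
  \sum_k quad_form A (row k V) = \tr (V *m A *m V^T).
Proof.
apply: eq_bigr => k _; rewrite /quad_form -row_mul mxE [RHS]mxE.
by apply: eq_bigr => i _; rewrite !mxE.
Qed.

Lemma sum_sqnorm_rows m (V : 'M[R]_(m, n)) :
  \sum_k sqnorm (row k V) = \tr (V *m V^T).
Proof.
apply: eq_bigr => k _; rewrite mxE.
by apply: eq_bigr => i _; rewrite !mxE expr2.
Qed.

(** Summing the tests over the rows of [V] replaces each quadratic form by the
    trace against [V^T V]. *)
Lemma trace_test m (V : 'M[R]_(m, n)) (A B : 'M[R]_n) (d : 'I_m -> R)
    (k K a eps : R) :
  (forall l, k * (quad_form A (row l V) - quad_form B (row l V))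
     + K * (a * quad_form B (row l V) + d l) - eps * sqnorm (row l V) <= 0) ->
  k * (\tr (V *m A *m V^T) - \tr (V *m B *m V^T))
    + K * (a * \tr (V *m B *m V^T) + \sum_l d l) - eps * \tr (V *m V^T) <= 0.
Proof.
move=> le0; rewrite -!sum_quad_form_rows -sum_sqnorm_rows.
rewrite -sumrB [a * _]mulr_sumr -big_split /= !mulr_sumr -big_split -sumrB.
by apply: sumr_le0 => l _; exact: le0.
Qed.

(** The arithmetic of the maximum principle. The letters stand for: [t1], [t0]
    the linearized operator applied to the translated and to the original
    function, [P1], [P0] the values of the nonlinear operator, [D] the energy of
    the gradient for the linearized operator, [T] the trace of its matrix. The
    first two terms of the test are nonnegative, so the energy term is
    controlled by the penalty. *)
Lemma bound_of_trace_test (k K a eps t1 t0 P1 P0 D G T N : R) :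
  0 <= k -> 0 <= K -> 0 <= eps ->
  k * (t1 - t0) + 2 * K * (a * t0 + D) - 2 * eps * T <= 0 ->
  t0 = P0 -> P1 <= t1 -> P0 <= P1 -> 0 <= a * P0 -> G <= D -> T <= N ->
  K * G <= eps * N.
Proof.
move=> k0 K0 eps0 main tP; rewrite {}tP in main; move=> Pt P01 aP GD TN.
have k1 : 0 <= k * (t1 - P0) by rewrite mulr_ge0 // subr_ge0 (le_trans P01).
have k2 : 0 <= K * (a * P0) by rewrite mulr_ge0.
have k3 : K * G <= K * D by rewrite ler_wpM2l.
have k4 : eps * T <= eps * N by rewrite ler_wpM2l.
lra.
Qed.

(** Bernstein's estimate at a maximum point of the auxiliary function. The
    linear operator is the one supporting [pucci_minus] at the Hessian of [u] at
    [x0]; it is applied to [u] translated by [w] as well, where it only gives an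
    inequality, in the favourable direction. No third derivative of [u]
    appears, since a difference quotient takes the place of a derivative. *)
Lemma gradient_at_max (lam Lam k K c eps P0 P1 : R) u w x0 :
  0 < lam -> lam <= Lam -> C2 u -> 0 <= k -> 0 <= K -> 0 <= eps ->
  (forall x, k * (u (x + w) - u x) + K * (u x - c) ^+ 2 - eps * sqnorm x <=
    k * (u (x0 + w) - u x0) + K * (u x0 - c) ^+ 2 - eps * sqnorm x0) ->
  pucci_minus lam Lam (hessian u x0) = P0 ->
  pucci_minus lam Lam (hessian u (x0 + w)) = P1 ->
  P0 <= P1 -> 0 <= (u x0 - c) * P0 ->
  K * (lam * sqnorm (gradient u x0)) <= eps * (n%:R * Lam).
Proof.
move=> lam0 lamLam u2 k0 K0 eps0 Qmax P0E P1E P01 P0_sign.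
have [m [V [VH VB Vell Vtr]]] :=
  pucci_minus_support lam0 lamLam (hessian_sym x0 u2).
have := VB _ (hessian_sym (x0 + w) u2); rewrite P1E => VHw.
pose D := \sum_k (dir_deriv u (row k V) x0) ^+ 2.
have ell : lam * sqnorm (gradient u x0) <= D.
  have := Vell (gradient u x0)^T.
  have -> : \sum_j ((gradient u x0)^T j 0) ^+ 2 = sqnorm (gradient u x0).
    by apply: eq_bigr => j _; rewrite mxE.
  move=> /le_trans; apply; rewrite le_eqVlt; apply/orP; left; apply/eqP.
  apply: eq_bigr => l _; congr (_ ^+ 2); rewrite mxE /dir_deriv.
  by apply: eq_bigr => i _; rewrite !mxE.
have main := trace_test (fun l => max_second_order (row l V) u2 Qmax).
exact: (bound_of_trace_test k0 K0 eps0 main (etrans VH P0E) VHw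
  P01 P0_sign ell Vtr).
Qed.

(** * The gradient of an entire solution *)

Lemma ler_coord_enorm v i : `|v 0 i| <= enorm v.
Proof.
rewrite -sqrtr_sqr ler_wsqrtr // (bigD1 i) //= lerDl.
by apply: sumr_ge0 => j _; exact: sqr_ge0.
Qed.

Lemma enormZ (t : R) v : enorm (t *: v) = `|t| * enorm v.
Proof.
rewrite /enorm -sqrtr_sqr -sqrtrM ?sqr_ge0 // mulr_sumr; congr Num.sqrt.
by apply: eq_bigr => i _; rewrite mxE exprMn.
Qed.

(** The local Hoelder bound on the gradient makes the difference quotients
    converge uniformly on balls. *)
Lemma uniform_difference_quotient u e (alpha r s : R) :
  C1 u -> 0 < alpha -> holder_loc alpha (gradient u) -> 0 < s ->
  exists2 h : R, 0 < h & forall y, `|y| <= r ->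
    `|h^-1 * (u (y + h *: e) - u y) - dir_deriv u e y| <= s.
Proof.
move=> u1 a0 hold s0.
have [L HL] := hold _ (@compact_norm_le (r + `|e|)).
pose E := \sum_i `|e 0 i|.
have E0 : 0 <= E by exact: sumr_ge0.
have L1 : 0 < `|L| * E + 1 by rewrite ltr_wpDl // mulr_ge0.
have e1 : 0 < enorm e + 1 by rewrite ltr_wpDl // sqrtr_ge0.
(* Chosen so that a displacement of Euclidean length at most [d] changes the
   derivative along [e] by at most [|L| E d^alpha <= s]. *)
pose d := (s / (`|L| * E + 1)) `^ alpha^-1.
have d0 : 0 < d by rewrite powR_gt0 // divr_gt0.
pose h := Num.min 1 (d / (enorm e + 1)).
have h0 : 0 < h by rewrite lt_min ltr01 divr_gt0.
have h1 : h <= 1 by rewrite ge_min lexx.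
have hd : h * enorm e <= d.
  apply: (@le_trans _ _ (h * (enorm e + 1))); first by rewrite ler_wpM2l ?(ltW h0) // lerDl.
  by rewrite -ler_pdivlMr // ge_min lexx orbT.
exists h => // y yr.
have [t [t0 t1 ->]] := dir_deriv_mean_value y (h *: e) u1.
set z := y + _.
rewrite dir_derivZ mulKf ?gt_eqF //.
have zy : z - y = (t * h) *: e by rewrite /z addrAC subrr add0r scalerA.
have th : `|t * h| <= h.
  by rewrite ger0_norm ?mulr_ge0 ?(ltW h0) // ler_piMl ?(ltW h0).
have Kz : `|z| <= r + `|e|.
  rewrite /z scalerA; apply: le_trans (ler_normD _ _) _; apply: lerD => //.
  by rewrite normrZ ler_piMl // (le_trans th).
have Ky : `|y| <= r + `|e| by rewrite (le_trans yr) // lerDl.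
have grad_zy : enorm (gradient u z - gradient u y) <= `|L| * (s / (`|L| * E + 1)).
  apply: le_trans (HL z y Kz Ky) _.
  apply: le_trans (ler_wpM2r (powR_ge0 _ _) (ler_norm L)) _.
  rewrite ler_wpM2l // zy enormZ.
  have dE : d `^ alpha = s / (`|L| * E + 1).
    by rewrite /d -powRrM mulVf ?gt_eqF // powRr1 // divr_ge0 // ltW.
  rewrite -dE; apply: ge0_ler_powR; rewrite ?nnegrE ?(ltW a0) ?(ltW d0) //.
    by rewrite mulr_ge0 ?sqrtr_ge0.
  by apply: le_trans hd; rewrite ler_wpM2r ?sqrtr_ge0.
rewrite /dir_deriv -sumrB; apply: le_trans (ler_norm_sum _ _ _) _.
apply: (@le_trans _ _ (\sum_i `|e 0 i| * (`|L| * (s / (`|L| * E + 1))))).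
  apply: ler_sum => i _; rewrite -mulrBr normrM ler_wpM2l //.
  apply: le_trans grad_zy.
  by have := ler_coord_enorm (gradient u z - gradient u y) i; rewrite !mxE.
rewrite -mulr_suml -/E mulrCA mulrA mulrCA ler_piMr ?(ltW s0) // ler_pdivrMr //.
by rewrite mul1r lerDl.
Qed.

(** The auxiliary function is [(u (y + h e) - u y) / h + s (u y - c) ^ 2 - s ^ 3
    |y| ^ 2]. With these weights the gradient at its maximum point is [O(s)] by
    [gradient_at_max], hence so are the maximum itself and, comparing with the
    value at [x], the derivative at [x]. *)
Lemma dir_deriv_le_multiple (lam Lam M C alpha c : R) (f : R -> R) u :
  0 < lam -> lam <= Lam -> C2 u ->
  (forall x, `|u x| <= M) -> (forall i x, `|partial i u x| <= C) ->
  0 < alpha -> holder_loc alpha (gradient u) ->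
  (forall x, pucci_minus lam Lam (hessian u x) = f (u x)) ->
  (forall x y, u x <= u y -> f (u x) <= f (u y)) ->
  `|c| <= M -> (forall x, 0 <= (u x - c) * f (u x)) ->
  forall e x, exists A : R, forall s : R, 0 < s -> s <= 1 -> dir_deriv u e x <= s * A.
Proof.
move=> lam0 lamLam u2 uM uC alpha0 hold u_sol f_mono cM f_sign e x.
have u1 := u2.1.
have Lam0 : 0 < Lam by exact: lt_le_trans lamLam.
pose E : R := \sum_i `|e 0 i|.
have E0 : 0 <= E by exact: sumr_ge0.
pose G : R := Num.sqrt (n%:R * Lam / lam).
pose M4 : R := (2 * M) ^+ 2.
have M40 : 0 <= M4 by exact: sqr_ge0.
have ucM y : (u y - c) ^+ 2 <= M4.
  have := uM y; move: cM; rewrite !ler_norml => /andP[? ?] /andP[? ?].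
  rewrite /M4 -[_ ^+ 2]real_normK ?num_real // ler_pXn2r ?nnegrE //; last by lra.
  by rewrite ler_norml; lra.
exists (G * E + 2 + M4 + sqnorm x) => s s0 s1.
pose B : R := `|C| * E + M4.
have B0 : 0 <= B by rewrite addr_ge0 // mulr_ge0.
have s3 : 0 < s ^+ 3 by rewrite exprn_gt0.
(* A radius for [exists_max_penalized] that is independent of [h]; [h] is
   chosen afterwards, depending on [r]. *)
pose r : R := `|x| + 2 * B / s ^+ 3 + 1.
have xr : `|x| <= r by rewrite /r -addrA lerDl addr_ge0 // divr_ge0 ?mulr_ge0 // ltW.
have [h h0 Hh] := uniform_difference_quotient e r u1 alpha0 hold s0.
pose phi y := h^-1 * (u (y + h *: e) - u y) + s * (u y - c) ^+ 2.
have phiB y : `|phi y| <= B.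
  apply: le_trans (ler_normD _ _) _; apply: lerD.
    have [t [_ _ ->]] := dir_deriv_mean_value y (h *: e) u1.
    rewrite dir_derivZ mulKf ?gt_eqF //; apply: ler_dir_deriv => i.
    exact: le_trans (uC _ _) (ler_norm _).
  rewrite normrM !ger0_norm ?sqr_ge0 ?(ltW s0) //.
  by apply: le_trans (ucM y); rewrite ler_piMl ?sqr_ge0.
have phic : continuous phi.
  have uc := C1_continuous u1.
  have ushift : continuous (fun y => u (y + h *: e)).
    move=> y; apply: (@continuous_comp _ _ _ (fun y => y + h *: e) u); last exact: uc.
    apply: (@continuousD _ _ _ id (cst (h *: e))); last exact: cst_continuous.
    exact: cvg_id.
  have uc' : continuous (fun y => u y - c).
    move=> y; apply: (@continuousB _ _ _ u (cst c)); first exact: uc.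
    exact: cst_continuous.
  move=> y; apply: (@continuousD _ _ _ (fun y => h^-1 * (u (y + h *: e) - u y))
    (fun y => s * (u y - c) ^+ 2)).
    apply: (@continuousM _ _ (cst h^-1) (fun y => u (y + h *: e) - u y)).
      exact: cst_continuous.
    by apply: (@continuousB _ _ _ (fun y => u (y + h *: e)) u); [exact: ushift|exact: uc].
  apply: (@continuousM _ _ (cst s) (fun y => (u y - c) ^+ 2)).
    exact: cst_continuous.
  apply: (@continuous_comp _ _ _ (fun y => u y - c) (fun t => t ^+ 2)); first exact: uc'.
  exact: exprn_continuous.
have Br : 2 * B <= s ^+ 3 * r ^+ 2.
  have b0 : 0 <= 2 * B / s ^+ 3 by rewrite divr_ge0 ?mulr_ge0 // ltW.
  rewrite [leRHS]mulrC -ler_pdivrMr //.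
  have r1 : 1 <= r by rewrite /r lerDr addr_ge0.
  apply: (@le_trans _ _ r); first by rewrite /r addrAC lerDr addr_ge0.
  by rewrite expr2 ler_peMl // (le_trans ler01).
have [x0 [x0r x0max]] := exists_max_penalized phic phiB s3 (le_trans (normr_ge0 _) xr) Br.
have quot_x0 : h^-1 * (u (x0 + h *: e) - u x0) <= s * (G * E + 1).
  (* The maximum principle applies only where the increment is nonnegative, as
     [f_mono] then compares the two equations; otherwise the bound is trivial. *)
  have [up|down] := leP (u x0) (u (x0 + h *: e)); last first.
    apply: (@le_trans _ _ 0); last first.
      by rewrite mulr_ge0 ?(ltW s0) // addr_ge0 // mulr_ge0 ?sqrtr_ge0.
    by rewrite pmulr_rle0 ?invr_gt0 // subr_le0 ltW.
  have grad_x0 : s * (lam * sqnorm (gradient u x0)) <= s ^+ 3 * (n%:R * Lam).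
    have hinv : 0 <= h^-1 by rewrite invr_ge0 ltW.
    exact: (gradient_at_max lam0 lamLam u2 hinv (ltW s0) (ltW s3) x0max
      (u_sol _) (u_sol _) (f_mono _ _ up) (f_sign x0)).
  have part_x0 i : `|partial i u x0| <= s * G.
    have sG0 : 0 <= s * G by rewrite mulr_ge0 ?sqrtr_ge0 ?(ltW s0).
    rewrite -(@ler_pXn2r _ 2) ?nnegrE // exprMn.
    rewrite sqr_sqrtr; last by rewrite !mulr_ge0 ?invr_ge0 ?ler0n ?ltW.
    apply: (@le_trans _ _ (sqnorm (gradient u x0))).
      rewrite real_normK ?num_real // /sqnorm (bigD1 i) //= mxE lerDl.
      by apply: sumr_ge0 => j _; exact: sqr_ge0.
    rewrite mulrA ler_pdivlMr // mulrC -(ler_pM2l s0).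
    by apply: le_trans grad_x0 _; rewrite [leRHS]mulrA -exprS.
  have := Hh x0 x0r; rewrite ler_norml => /andP[_].
  have := ler_dir_deriv e part_x0; rewrite -/E ler_norml => /andP[_].
  have -> : s * (G * E + 1) = s * G * E + s by ring.
  lra.
have := Hh x xr; rewrite ler_norml => /andP[Hx _].
have := x0max x; rewrite /phi => Hmax.
have sq_x := mulr_ge0 (ltW s0) (sqr_ge0 (u x - c)).
have sq_x0 : s * (u x0 - c) ^+ 2 <= s * M4 by rewrite ler_wpM2l ?(ltW s0).
have s3x0 : 0 <= s ^+ 3 * sqnorm x0 by rewrite mulr_ge0 ?sqnorm_ge0 ?(ltW s3).
have s3x : s ^+ 3 * sqnorm x <= s * sqnorm x.
  by rewrite ler_wpM2r ?sqnorm_ge0 // exprS ler_piMr ?(ltW s0) // exprn_ile1 // ltW.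
have -> : s * (G * E + 2 + M4 + sqnorm x) =
  s * (G * E + 1) + s + s * M4 + s * sqnorm x by ring.
lra.
Qed.

Lemma le0_of_le_multiples (a A : R) : (forall s, 0 < s -> s <= 1 -> a <= s * A) -> a <= 0.
Proof.
move=> aA; rewrite leNgt; apply/negP => a0.
have A0 : 0 < A by have := aA 1 ltr01 (lexx _); rewrite mul1r; apply: lt_le_trans.
pose s := Num.min 1 (a / (2 * A)).
have s0 : 0 < s by rewrite lt_min ltr01 divr_gt0 // mulr_gt0.
have s1 : s <= 1 by rewrite ge_min lexx.
have sa : s * (2 * A) <= a by rewrite -ler_pdivlMr ?mulr_gt0 // ge_min lexx orbT.
have := aA s s0 s1; lra.
Qed.

End Euclidean_calculus.

Unset Implicit Arguments.

Theorem corollary4p3 (R : realType) (n : nat) (lam Lam : R)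
  (lam_gt0 : 0 < lam) (lam_le : lam <= Lam)
  (F : R -> R)
  (F_derivable : forall t : R, derivable F t 1)
  (F'_derivable : forall t : R, derivable F^`() t 1)
  (u : 'rV[R]_n -> R)
  (u_C2 : C2 u)
  (u_bounded : bounded_fun u)
  (u_holder : exists alpha : R, 0 < alpha < 1 /\ holder_loc alpha (gradient u))
  (u_gradient : exists C : R, 0 < C /\ forall x, enorm (gradient u x) <= C)
  (u_sol : forall x, pucci_minus lam Lam (hessian u x) = F^`() (u x))
  (F''_ge0 : forall x, 0 <= F^`()^`() (u x)) :
  exists c : R, forall x, u x = c.
Proof.
have [alpha [/andP[alpha0 _] hold]] := u_holder.
have [C [C0 uC]] := u_gradient.
have [M M0 uM] : exists2 M : R, 0 <= M & forall x, `|u x| <= M.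
  have [M [_ HM]] := u_bounded.
  exists (`|M| + 1) => [|x]; first by rewrite addr_ge0.
  by apply: HM => //; rewrite (le_lt_trans (ler_norm _)) // ltrDl.
have f_mono := monotone_on_range (C1_continuous u_C2.1) F'_derivable F''_ge0.
have [c cM f_sign] := sign_change_point M0 uM f_mono.
have uC' i x : `|partial i u x| <= C.
  apply: le_trans (uC x).
  by have := ler_coord_enorm (gradient u x) i; rewrite mxE.
(* As [x] and [e] are arbitrary, this already forces equality. *)
have decr e x : u (x + e) <= u x.
  have [s [_ _ D]] := dir_deriv_mean_value x e u_C2.1.
  rewrite -subr_le0 D.
  have [A HA] := dir_deriv_le_multiple lam_gt0 lam_le u_C2 uM uC' alpha0 hold
    u_sol f_mono cM f_sign e (x + s *: e).
  exact: le0_of_le_multiples HA.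
exists (u 0) => x; apply/eqP; rewrite eq_le.
have -> : u x <= u 0 by have := decr x 0; rewrite add0r.
by have := decr (- x) x; rewrite subrr.
Qed.
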